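(* Let $n\ge1$ and let $S=\{(x_1,y_1),\ldots,(x_n,y_n)\}$ be a set of $n$ distinct arrows on $\{1,\ldots,n+1\}$. Then $S$ is the arrow representation of a facet of Simion's type $B$ associahedron $\Gamma_n^B$ if and only if all of the following hold: (1) there is exactly one $k$ with $1\le k\le n+1$ such that $(k-1,k)\in S$ (with $(n+1,1)$ in place of $(k-1,k)$ when $k=1$); (2) no backward arrow of $S$ nests a forward arrow of $S$ (in particular, if $k>1$, no backward arrow nests $(k-1,k)$); (3) if $k=1$ then $S$ contains no forward arrow; (4) any two forward arrows of $S$ nest; in particular, if $k>1$ then every forward arrow $(x,y)\in S$ satisfies $x\le k-1$ and $y\ge k$; (5) no head of an arrow of $S$ is the tail of another arrow of $S$; (6) no two arrows of $S$ cross.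
   Context: Label the vertices of a regular $(2n+2)$-gon clockwise by $1,\ldots,n+1,\overline{1},\ldots,\overline{n+1}$. A $B$-diagonal is either a diameter $\{i,\overline{i}\}$ ($1\le i\le n+1$), or $\{\{i,j\},\{\overline{i},\overline{j}\}\}$ with $1\le i<i+1<j\le n+1$, or $\{\{i,\overline{j}\},\{\overline{i},j\}\}$ with $1\le j<i\le n+1$. Two $B$-diagonals cross if a diagonal of one and a diagonal of the other meet in the interior of the polygon. $\Gamma_n^B$ is the simplicial complex on the $B$-diagonals whose faces are the pairwise noncrossing sets; it is the boundary complex of an $n$-dimensional simplicial polytope, so its facets have $n$ elements. An arrow $(i,j)$, $i\neq j$ in $\{1,\ldots,n+1\}$, has tail $i$ and head $j$; it is forward if $i<j$ and backward if $i>j$. The arrow representation maps $B$-diagonals to arrows: $\{i,\overline{i}\}\mapsto(i-1,i)$ for $2\le i\le n+1$, $\{1,\overline{1}\}\mapsto(n+1,1)$; $\{\{i,j\},\{\overline{i},\overline{j}\}\}\mapsto(j-1,i)$ for $1\le i<i+1<j\le n+1$; $\{\{i,\overline{j}\},\{\overline{i},j\}\}\mapsto(j-1,i)$ for $2\le j<i\le n+1$; $\{\{1,\overline{i}\},\{\overline{1},i\}\}\mapsto(n+1,i)$ for $2\le i\le n+1$. The interval of an arrow $(x,y)$ is $\{\min(x,y),\ldots,\max(x,y)\}$. Two arrows cross if their intervals $[a_1,a_2]$, $[b_1,b_2]$ satisfy $a_1<b_1<a_2<b_2$ or $b_1<a_1<b_2<a_2$; an arrow nests another if its interval contains the other's interval;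 two arrows nest if one nests the other.
   Formalization: The pair {{n+1, 1̄}, {1, overline(n+1)}}, which the stated ranges admit as a B-diagonal, consists of two sides of the polygon and would map to the loop (n+1,n+1); it is excluded from the B-diagonals and from the arrow representation. *)

(* Defs.v *)
From mathcomp Require Import all_boot all_order all_algebra.
From mathcomp Require Import all_classical all_reals all_analysis.
Import Order.TTheory GRing.Theory Num.Theory.
Import numFieldNormedType.Exports.

Set Implicit Arguments.
Unset Strict Implicit.
Unset Printing Implicit Defensive.

(* Labels 1, ..., n+1 are shifted down by one: the label i+1 is the element   *)
(* of 'I_n.+1 with value i. In particular label 1 is ord0 and label n+1 is    *)
(* ord_max.                                                                   *)

(* (i, false) is the vertex i and (i, true) is the vertex \overline{i}. *)
Definition vertex (n : nat) : finType := ('I_n.+1 * bool)%type.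

Definition lab n (i : 'I_n.+1) : vertex n := (i, false).
Definition bar n (i : 'I_n.+1) : vertex n := (i, true).

Section Geometry.
Variables (R : realType) (n : nat).
Local Open Scope ring_scope.

Definition clockwise_rank (v : vertex n) : nat := (v.1 + v.2 * n.+1)%N.

(* Decreasing angles, so that the labelling is clockwise. *)
Definition position (v : vertex n) : R^o * R^o :=
  let t := 2 * pi * (clockwise_rank v)%:R / (2 * n + 2)%N%:R in
  (cos (- t), sin (- t)).

Definition polygon : set (R^o * R^o) :=
  [set p | exists w : vertex n -> R,
     [/\ forall v, 0 <= w v, \sum_v w v = 1 & p = \sum_v w v *: position v]
  ]%classic.

Definition segment (p q : R^o * R^o) : set (R^o * R^o) :=
  [set r | exists2 t : R, 0 <= t <= 1 & r = (1 - t) *: p + t *: q]%classic.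

Definition meet_inside (d e : {set vertex n}) : Prop :=
  exists u v x y : vertex n,
    [/\ d = [set u; v]%SET, e = [set x; y]%SET &
      exists p, [/\ segment (position u) (position v) p,
                    segment (position x) (position y) p &
                    interior polygon p]].

Definition Bcross (D E : {set {set vertex n}}) : Prop :=
  exists d e, [/\ d \in D, e \in E & meet_inside d e].

End Geometry.

Section Bdiagonals.
Variable n : nat.
Local Open Scope set_scope.

Definition diameter (i : 'I_n.+1) : {set {set vertex n}} :=
  [set [set lab i; bar i]].

Definition unmixed_pair (i j : 'I_n.+1) : {set {set vertex n}} :=
  [set [set lab i; lab j]; [set bar i; bar j]].

Definition mixed_pair (i j : 'I_n.+1) : {set {set vertex n}} :=
  [set [set lab i; bar j]; [set bar i; lab j]].

(* For labels i = n+1 and j = 1 the segments {i, \overline{j}} and            *)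
(* {\overline{i}, j} are sides of the polygon, hence not diagonals.           *)
Inductive Bdiagonal : {set {set vertex n}} -> Prop :=
| Bdiameter i : Bdiagonal (diameter i)
| Bunmixed (i j : 'I_n.+1) of (i.+1 < j)%N : Bdiagonal (unmixed_pair i j)
| Bmixed (i j : 'I_n.+1) of (j < i)%N & (i, j) != (ord_max, ord0) :
    Bdiagonal (mixed_pair i j).

Definition face (R : realType) (F : {set {set {set vertex n}}}) : Prop :=
  (forall D, D \in F -> Bdiagonal D) /\
  (forall D E, D \in F -> E \in F -> D != E -> ~ Bcross R D E).

Definition facet (R : realType) (F : {set {set {set vertex n}}}) : Prop :=
  face R F /\ (forall G, face R G -> F \subset G -> G = F).

End Bdiagonals.

Section Arrows.
Variable n : nat.

(* (tail, head) *)
Definition arrow : finType := ('I_n.+1 * 'I_n.+1)%type.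

Implicit Types a b : arrow.

Definition is_arrow a : bool := a.1 != a.2.
Definition forward a : bool := (a.1 < a.2)%N.
Definition backward a : bool := (a.2 < a.1)%N.

Definition diameter_arrow (k : 'I_n.+1) : arrow :=
  if k == ord0 then (ord_max, ord0) else (ord_pred k, k).

(* The graph of the map from B-diagonals to arrows. *)
Inductive arrow_rep : {set {set vertex n}} -> arrow -> Prop :=
| rep_diameter i : arrow_rep (diameter i) (diameter_arrow i)
| rep_unmixed (i j : 'I_n.+1) of (i.+1 < j)%N :
    arrow_rep (unmixed_pair i j) (ord_pred j, i)
| rep_mixed (i j : 'I_n.+1) of (0 < j < i)%N :
    arrow_rep (mixed_pair i j) (ord_pred j, i)
| rep_mixed1 (i : 'I_n.+1) of (0 < i < n)%N :
    arrow_rep (mixed_pair i ord0) (ord_max, i).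

Definition arrow_lo a : nat := minn a.1 a.2.
Definition arrow_hi a : nat := maxn a.1 a.2.

Definition arrow_interval a : {set 'I_n.+1} :=
  [set z : 'I_n.+1 | (arrow_lo a <= z <= arrow_hi a)%N]%SET.

Definition nests a b : bool := arrow_interval b \subset arrow_interval a.

Definition arrow_cross a b : bool :=
  (arrow_lo a < arrow_lo b < arrow_hi a)%N && (arrow_hi a < arrow_hi b)%N
  || (arrow_lo b < arrow_lo a < arrow_hi b)%N && (arrow_hi b < arrow_hi a)%N.

Definition represents (S : {set arrow}) (F : {set {set {set vertex n}}})
    : Prop :=
  forall a, a \in S <-> exists2 D, D \in F & arrow_rep D a.

End Arrows.

(* Main.v *)
Require Import Defs.
From mathcomp Require Import all_boot all_order all_algebra.
From mathcomp Require Import all_classical all_reals all_analysis.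
From mathcomp Require Import ring lra zify.
Import Order.TTheory GRing.Theory Num.Theory.
Import numFieldNormedType.Exports.

Set Implicit Arguments.
Unset Strict Implicit.
Unset Printing Implicit Defensive.

(* The arrow representation is a bijection from B-diagonals to arrows, and two
   distinct B-diagonals are noncrossing exactly when their arrows satisfy (2),
   (4), (5) and (6) pairwise; for diameters this means that they always cross.
   Hence everything but the existence of k in (1) is a pairwise condition.
   Unfolding a noncrossing set of m B-diagonals, d of which are diameters,
   gives 2m - d noncrossing diagonals of the (2n+2)-gon, so 2m - d <= 2n - 1.
   As d <= 1 this yields m <= n, with equality only if d = 1: so a noncrossing
   set of size n is maximal and contains exactly one diameter. *)

(** * Orientation and crossing segments in the plane *)

Section Plane.
Variable R : realType.
Local Open Scope ring_scope.
Implicit Types p q r u v x y : R^o * R^o.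

(** Twice the signed area of the triangle [p q r], positive when it is traversed
    counterclockwise. *)
Definition orient p q r : R :=
  (q.1 - p.1) * (r.2 - p.2) - (q.2 - p.2) * (r.1 - p.1).

(** [orient u v] is affine in its last argument and vanishes on the line through [u] and [v]. *)
Lemma orient_segment u v x y p (t : R) :
  segment u v p -> p = (1 - t) *: x + t *: y ->
  (1 - t) * orient u v x + t * orient u v y = 0.
Proof.
move=> [s _ ->] /pair_equal_spec [/= e1 e2].
have {}e1 : (1 - s) * u.1 + s * v.1 = (1 - t) * x.1 + t * y.1 := e1.
have {}e2 : (1 - s) * u.2 + s * v.2 = (1 - t) * x.2 + t * y.2 := e2.
rewrite /orient.
have -> : (1 - t) * ((v.1 - u.1) * (x.2 - u.2) - (v.2 - u.2) * (x.1 - u.1)) +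
  t * ((v.1 - u.1) * (y.2 - u.2) - (v.2 - u.2) * (y.1 - u.1)) =
  (v.1 - u.1) * (((1 - t) * x.2 + t * y.2) - u.2) -
  (v.2 - u.2) * (((1 - t) * x.1 + t * y.1) - u.1) by ring.
by rewrite -e1 -e2; ring.
Qed.

(** The affine function [orient u v] changes sign between [x] and [y], and so does [orient x y]
    between [u] and [v]. Their zeros on these segments turn out to be the same point. *)
Lemma segments_meet u v x y :
  orient u v x * orient u v y < 0 -> orient x y u * orient x y v < 0 ->
  exists p, segment u v p /\ segment x y p.
Proof.
have split (a b : R) : a * b < 0 -> 0 <= a / (a - b) <= 1 /\ a - b != 0.
  move=> ab; have anb : a - b != 0 by apply/eqP => e; nra.
  split=> //; case: (ltrP 0 a) => a0.
    have b0 : b < 0 by nra.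
    by rewrite ler_pdivlMr ?ler_pdivrMr; lra.
  have b0 : 0 < b by nra.
  by rewrite ler_ndivlMr ?ler_ndivrMr; lra.
move=> /split [t01 t0] /split [s01 s0].
(* Both differences are, up to sign, the cross product of [v - u] and [y - x], so the two parameters
   share a denominator. *)
have e : orient x y u - orient x y v = - (orient u v x - orient u v y).
  by rewrite /orient; ring.
move: t01 s01; set s := orient x y u / _; set t := orient u v x / _ => t01 s01.
have ds : (orient u v x - orient u v y) * s = - orient x y u.
  by rewrite /s e invrN mulrN mulrN mulrCA mulfV ?mulr1.
have dt : (orient u v x - orient u v y) * t = orient u v x.
  by rewrite mulrCA mulfV ?mulr1.
exists ((1 - s) *: u + s *: v); split; first by exists s.
exists t => //.
have key (a b c d : R) : (orient u v x - orient u v y) * (a - c)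
    - orient x y u * (b - a) - orient u v x * (d - c) = 0 ->
    (1 - s) * a + s * b = (1 - t) * c + t * d.
  move=> h; apply: (mulfI t0); apply/eqP; rewrite -subr_eq0 -h; apply/eqP.
  by rewrite -[in RHS]mulNr -ds -[X in _ = _ - X * _]dt; ring.
apply/pair_equal_spec; rewrite /= /GRing.scale /=.
by split; apply: key; rewrite /orient; ring.
Qed.

(* Two independent directions span a neighbourhood of the crossing point. *)
Lemma crossing_interior (A : set (R^o * R^o)) u v x y p :
  (forall a b (t : R), A a -> A b -> 0 <= t <= 1 -> A ((1 - t) *: a + t *: b)) ->
  A u -> A v -> A x -> A y ->
  orient u v x * orient u v y < 0 -> orient x y u * orient x y v < 0 ->
  segment u v p -> segment x y p -> interior A p.
Proof.
move=> Acvx Au Av Ax Ay Ouv Oxy suv sxy.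
case: (suv) => s s01 ps; case: (sxy) => t t01 pt.
have ht := orient_segment suv pt; have hs := orient_segment sxy ps.
(* An affine function with end values of opposite strict signs does not vanish at an end, so [p] is
   inside both segments. *)
have strict (a b r : R) : 0 <= r <= 1 -> (1 - r) * a + r * b = 0 -> a * b < 0 ->
    0 < r < 1.
  move=> /andP[r0 r1] e ab; rewrite !lt_neqAle r0 r1 !andbT.
  apply/andP; split; apply/eqP => er.
    by move: e ab; rewrite -er subr0 mul1r !mul0r addr0 => ->; rewrite mul0r ltxx.
  by move: e ab; rewrite er subrr mul1r mul0r add0r => ->; rewrite mulr0 ltxx.
have {hs} /andP[s0 s1] := strict _ _ _ s01 hs Oxy.
have {ht} /andP[t0 t1] := strict _ _ _ t01 ht Ouv.
pose d : R := (v.1 - u.1) * (y.2 - x.2) - (v.2 - u.2) * (y.1 - x.1).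
have d0 : d != 0.
  have -> : d = orient u v y - orient u v x by rewrite /orient /d; ring.
  by apply/eqP => e; nra.
(* The room left for both parameters before they leave the interval from 0 to 1. *)
pose m : R := Num.min (Num.min s (1 - s)) (Num.min t (1 - t)).
have m0 : 0 < m by rewrite !lt_min s0 t0 !subr_gt0 s1 t1.
pose K : R := 1 + `|v.1 - u.1| + `|v.2 - u.2| + `|y.1 - x.1| + `|y.2 - x.2|.
have K0 : 0 < K.
  have := (normr_ge0 (v.1 - u.1), normr_ge0 (v.2 - u.2), normr_ge0 (y.1 - x.1),
           normr_ge0 (y.2 - x.2)).
  by rewrite /K => -[[[? ?] ?] ?]; lra.
(* This radius keeps twice the coefficients [a] and [b] introduced below smaller than [m]. *)
pose e : R := m * `|d| / (2 * K).
have small (a b c1 c2 : R) : `|a| < e -> `|b| < e -> `|c1| + `|c2| <= K ->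
    `|2 * ((a * c1 - b * c2) / d)| < m.
  move=> ae be cK; rewrite !normrM normfV (ger0_norm (ler0n _ 2)) mulrA.
  rewrite ltr_pdivrMr ?normr_gt0 //.
  have -> : m * `|d| = 2 * (e * K).
    by rewrite /e; field; rewrite gt_eqF.
  rewrite ltr_pM2l //.
  apply: (le_lt_trans (ler_normB _ _)); rewrite !normrM.
  apply: (@le_lt_trans _ _ (Num.max `|a| `|b| * K)); last first.
    by rewrite ltr_pM2r // gt_max ae be.
  apply: (@le_trans _ _ (Num.max `|a| `|b| * (`|c1| + `|c2|))).
    by rewrite mulrDr lerD // ler_wpM2r // le_max lexx ?orbT.
  by rewrite ler_wpM2l // le_max normr_ge0.
apply/nbhs_ballP; exists e.
  by rewrite /= divr_gt0 ?mulr_gt0 ?normr_gt0.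
move=> q [/= q1 q2].
have {}q1 : `|q.1 - p.1| < e by rewrite distrC.
have {}q2 : `|q.2 - p.2| < e by rewrite distrC.
(* Cramer's rule with determinant [d] for [q - p] in the basis [v - u], [y - x]. *)
pose a : R := ((q.1 - p.1) * (y.2 - x.2) - (q.2 - p.2) * (y.1 - x.1)) / d.
pose b : R := ((q.2 - p.2) * (v.1 - u.1) - (q.1 - p.1) * (v.2 - u.2)) / d.
have am : `|2 * a| < m.
  apply: small => //; rewrite /K.
  have := normr_ge0 (v.1 - u.1); have := normr_ge0 (v.2 - u.2); lra.
have bm : `|2 * b| < m.
  apply: small => //; rewrite /K.
  have := normr_ge0 (y.1 - x.1); have := normr_ge0 (y.2 - x.2); lra.
have inside (r c : R) : `|2 * c| < m -> m <= r -> m <= 1 - r -> 0 <= r + 2 * c <= 1.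
  by rewrite ltr_norml => /andP[? ?] ? ?; lra.
have sa : 0 <= s + 2 * a <= 1 by apply: inside => //; rewrite !ge_min lexx ?orbT.
have tb : 0 <= t + 2 * b <= 1 by apply: inside => //; rewrite !ge_min lexx ?orbT.
have da : d * a = (q.1 - p.1) * (y.2 - x.2) - (q.2 - p.2) * (y.1 - x.1).
  by rewrite mulrCA mulfV ?mulr1.
have db : d * b = (q.2 - p.2) * (v.1 - u.1) - (q.1 - p.1) * (v.2 - u.2).
  by rewrite mulrCA mulfV ?mulr1.
have key (pi qi ui vi xi yi : R) :
    pi = (1 - s) * ui + s * vi -> pi = (1 - t) * xi + t * yi ->
    d * (qi - pi) = d * a * (vi - ui) + d * b * (yi - xi) ->
    (1 - 2^-1) * ((1 - (s + 2 * a)) * ui + (s + 2 * a) * vi) +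
      2^-1 * ((1 - (t + 2 * b)) * xi + (t + 2 * b) * yi) = qi.
  move=> e1 e2; rewrite -[d * a * _]mulrA -[d * b * _]mulrA -mulrDr => /(mulfI d0) e3.
  have -> : qi = pi + (a * (vi - ui) + b * (yi - xi)) by rewrite -e3; ring.
  have -> : pi = 2^-1 * pi + 2^-1 * pi by field.
  by rewrite {1}e1 e2; field.
have [p1s p2s] : p.1 = (1 - s) * u.1 + s * v.1 /\ p.2 = (1 - s) * u.2 + s * v.2.
  by rewrite ps.
have [p1t p2t] : p.1 = (1 - t) * x.1 + t * y.1 /\ p.2 = (1 - t) * x.2 + t * y.2.
  by rewrite pt.
have half : 0 <= (2^-1 : R) <= 1 by rewrite invr_ge0 ler0n invf_le1 ?ler1n ?ltr0n.
(* [q] is the midpoint of a point on each segment, obtained by moving [p] by twice its component in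
   that direction. *)
suff <- : (1 - 2^-1) *: ((1 - (s + 2 * a)) *: u + (s + 2 * a) *: v) +
    2^-1 *: ((1 - (t + 2 * b)) *: x + (t + 2 * b) *: y) = q.
  exact: (Acvx _ _ _ (Acvx _ _ _ Au Av sa) (Acvx _ _ _ Ax Ay tb) half).
rewrite [q]surjective_pairing; apply/pair_equal_spec; split.
  by apply: key p1s p1t _; rewrite da db /d; ring.
by apply: key p2s p2t _; rewrite da db /d; ring.
Qed.

End Plane.

(** * Vertices of the regular polygon on the unit circle *)

Section Circle.
Variables (R : realType) (n : nat).
Local Open Scope ring_scope.
Implicit Types u v w x y : vertex n.

(** [position v] lies at minus twice this angle. Halving makes sines of differences of these angles
    measure chords. *)
Definition half_angle v : R := pi * (clockwise_rank v)%:R / (2 * n + 2)%N%:R.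

Lemma position_half v (a := half_angle v) :
  position R v = (cos a ^+ 2 - sin a ^+ 2, - (2 * sin a * cos a)).
Proof.
rewrite /position (_ : 2 * pi * _ / _ = a + a); last by rewrite /a /half_angle; ring.
by rewrite cosN sinN cosD sinD; congr pair; ring.
Qed.

Lemma clockwise_rank_lt v : (clockwise_rank v < 2 * n + 2)%N.
Proof.
by case: v => [i b]; have := ltn_ord i; rewrite /clockwise_rank /=; case: b; lia.
Qed.

Lemma clockwise_rank_inj : injective (@clockwise_rank n).
Proof.
move=> [i b] [j c]; rewrite /clockwise_rank /= => e.
have ? := ltn_ord i; have ? := ltn_ord j.
have ebc : b = c by case: b c e => [] [] //=; lia.
by rewrite ebc in e *; congr pair; apply: val_inj => /=; lia.
Qed.

(** Half the signed length of the chord from [u] to [v] of the unit circle. *)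
Definition chord_sine u v : R := sin (half_angle v - half_angle u).

Lemma chord_sineC u v : chord_sine u v = - chord_sine v u.
Proof. by rewrite /chord_sine -sinN opprB. Qed.

(** All half angles lie between 0 (included) and [pi] (excluded) and increase with the rank. *)
Lemma chord_sine_gt0 u v :
  (clockwise_rank u < clockwise_rank v)%N -> 0 < chord_sine u v.
Proof.
move=> uv; have vN := clockwise_rank_lt v.
have N0 : 0 < (2 * n + 2)%N%:R :> R by rewrite ltr0n; lia.
have pi0 := pi_gt0 R.
apply: sin_gt0_pi; rewrite /half_angle -mulrBl -mulrBr; apply/andP; split.
  by apply: divr_gt0 => //; apply: mulr_gt0 => //; rewrite subr_gt0 ltr_nat.
rewrite ltr_pdivrMr // ltr_pM2l //.
rewrite ltrBlDr -natrD ltr_nat; lia.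
Qed.

(* Homogenizing with [cos ^+ 2 + sin ^+ 2] turns [orient] into a Vandermonde
   determinant in the half angles. *)
Lemma orient_position u v w :
  orient (position R u) (position R v) (position R w) =
  - 4 * (chord_sine u v * chord_sine v w * chord_sine u w).
Proof.
rewrite !position_half /orient /chord_sine !sinB /=.
have h z := cos2Dsin2 (half_angle z).
have Hu := h u; have Hv := h v; have Hw := h w.
set cu := cos (half_angle u) in Hu *; set su := sin (half_angle u) in Hu *.
set cv := cos (half_angle v) in Hv *; set sv := sin (half_angle v) in Hv *.
set cw := cos (half_angle w) in Hw *; set sw := sin (half_angle w) in Hw *.
(* Each two-vertex minor gets the factor [cos ^+ 2 + sin ^+ 2] of the vertex that it omits, which
   makes both sides quadratic in each of the three vertices. *)
have e (k1 k2 k3 a b c a' b' c' : R) : k1 = 1 -> k2 = 1 -> k3 = 1 ->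
  (b - a) * (c' - a') - (b' - a') * (c - a) =
  k1 * (b * c' - b' * c) - k2 * (a * c' - a' * c) + k3 * (a * b' - a' * b).
  by move=> -> -> ->; ring.
by rewrite (e _ _ _ _ _ _ _ _ _ Hu Hv Hw); ring.
Qed.

Lemma norm_position v : (position R v).1 ^+ 2 + (position R v).2 ^+ 2 = 1.
Proof. exact: cos2Dsin2. Qed.

Lemma polygon_vertex v : @polygon R n (position R v).
Proof.
exists (fun w => (w == v)%:R); split=> [w||]; first by rewrite ler0n.
  by rewrite (bigD1 v) //= eqxx big1 ?addr0 // => w /negPf ->.
rewrite (bigD1 v) //= eqxx scale1r big1 ?addr0 // => w /negPf ->.
exact: scale0r.
Qed.

Lemma polygon_convex a b (t : R) : @polygon R n a -> @polygon R n b ->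
  0 <= t <= 1 -> @polygon R n ((1 - t) *: a + t *: b).
Proof.
move=> [wa [a0 a1 ->]] [wb [b0 b1 ->]] /andP[t0 t1].
exists (fun v => (1 - t) * wa v + t * wb v); split=> [v||].
- by rewrite addr_ge0 ?mulr_ge0 // subr_ge0.
- by rewrite big_split /= -!mulr_sumr a1 b1; ring.
under [RHS]eq_bigr => v _ do rewrite scalerDl -!scalerA.
by rewrite [RHS]big_split !scaler_sumr.
Qed.

(* The polygon is on one side of the tangent line at a vertex. *)
Lemma vertex_not_interior v : ~ interior (@polygon R n) (position R v).
Proof.
move=> /nbhs_ballP[e /= e0].
have := norm_position v; set a := (position R v).1; set b := (position R v).2 => ab.
have small c : c ^+ 2 <= 1 -> `|c - (1 + e / 2) * c| < e.
  move=> c1; have -> : c - (1 + e / 2) * c = - (e / 2 * c) by ring.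
  rewrite normrN normrM ger0_norm ?divr_ge0 ?ltW //.
  have : `|c| <= 1 by rewrite -(@expr_le1 _ 2) // real_normK ?num_real.
  by have := normr_ge0 c; nra.
(* The vertex pushed radially outwards, by little enough to stay in the ball. *)
move=> /(_ ((1 + e / 2) * a, (1 + e / 2) * b)) [].
  by split; apply: small; nra.
move=> w [w0 w1 eab].
have /= ea := congr1 fst eab; have /= eb := congr1 snd eab.
have {}ea : (1 + e / 2) * a = \sum_v w v * (position R v).1.
  by rewrite ea (big_morph fst (id1 := 0) (op1 := +%R)).
have {}eb : (1 + e / 2) * b = \sum_v w v * (position R v).2.
  by rewrite eb (big_morph snd (id1 := 0) (op1 := +%R)).
(* The scalar product with [(a, b)] is at most 1 at every vertex, hence on the polygon, but it is
   [1 + e / 2] at the pushed point. *)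
have : \sum_v w v * ((position R v).1 * a + (position R v).2 * b) <= 1.
  rewrite -w1; apply: ler_sum => z _; rewrite ler_piMr //.
  have := sqr_ge0 ((position R z).1 - a); have := sqr_ge0 ((position R z).2 - b).
  by have := norm_position z; nra.
have -> : \sum_v w v * ((position R v).1 * a + (position R v).2 * b) =
    (1 + e / 2) * (a ^+ 2 + b ^+ 2).
  rewrite mulrDr !expr2 !mulrA ea eb !mulr_suml -big_split /=.
  by apply: eq_bigr => z _; ring.
by rewrite ab; lra.
Qed.

End Circle.

(** * Crossing chords of the regular polygon *)

Definition interleave (c d : nat * nat) : bool :=
  ((c.1 < d.1 < c.2) && (c.2 < d.2)) || ((d.1 < c.1 < d.2) && (d.2 < c.2)).

Lemma set2_eq (T : finType) (a b c d : T) :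
  [set a; b]%SET = [set c; d]%SET -> (a, b) = (c, d) \/ (a, b) = (d, c).
Proof.
move=> e.
have := set21 a b; rewrite e => /set2P[] ac.
  have := set22 c d; rewrite -e => /set2P[] db; last by left; rewrite ac db.
  by have := set22 a b; rewrite e => /set2P[] bc; [left|left]; congr pair; congruence.
have := set21 c d; rewrite -e => /set2P[] ca; last by right; rewrite ca ac.
by have := set22 a b; rewrite e => /set2P[] bc; right; congr pair; congruence.
Qed.

Section Crossing.
Variables (R : realType) (n : nat).
Local Open Scope ring_scope.
Implicit Types u v w x y : vertex n.
Let rank := @clockwise_rank n.

Lemma segmentC (p q : R^o * R^o) : segment p q = segment q p.
Proof.
by apply/seteqP; split=> r [t /andP[t0 t1] ->]; exists (1 - t);
  rewrite ?subr_ge0 ?t1 ?gerBl // subKr addrC.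
Qed.

(** The labelling is clockwise, so vertices ranked between [u] and [v] are to the left of the
    directed chord. *)
Lemma orient_inside u v w : (rank u < rank w < rank v)%N ->
  0 < orient (position R u) (position R v) (position R w).
Proof.
move=> /andP[uw wv]; rewrite orient_position (chord_sineC _ v w).
have := chord_sine_gt0 R (ltn_trans uw wv).
have := chord_sine_gt0 R uw; have := chord_sine_gt0 R wv.
by move=> a b c; have := mulr_gt0 a (mulr_gt0 b c); nra.
Qed.

Lemma orient_outside u v w : (rank u < rank v)%N ->
  (rank w < rank u)%N || (rank v < rank w)%N ->
  orient (position R u) (position R v) (position R w) < 0.
Proof.
move=> uv; rewrite orient_position; have a := chord_sine_gt0 R uv.
move=> /orP[wu|vw].
  rewrite (chord_sineC _ v w) (chord_sineC _ u w).
  have b := chord_sine_gt0 R wu; have c := chord_sine_gt0 R (ltn_trans wu uv).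
  by have := mulr_gt0 a (mulr_gt0 b c); nra.
have b := chord_sine_gt0 R vw; have c := chord_sine_gt0 R (ltn_trans uv vw).
by have := mulr_gt0 a (mulr_gt0 b c); nra.
Qed.

Lemma orient_endpoint (p q : R^o * R^o) : orient p q p = 0 /\ orient p q q = 0.
Proof. by rewrite /orient; split; ring. Qed.

Lemma interleave_segments_meet u v x y :
  (rank u < rank x < rank v)%N -> (rank v < rank y)%N ->
  meet_inside R [set u; v]%SET [set x; y]%SET.
Proof.
move=> /andP[ux xv] vy; exists u, v, x, y; split=> //.
have O1 : orient (position R u) (position R v) (position R x) *
    orient (position R u) (position R v) (position R y) < 0.
  rewrite pmulr_rlt0; first by apply: orient_outside; lia.
  by apply: orient_inside; lia.
have O2 : orient (position R x) (position R y) (position R u) *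
    orient (position R x) (position R y) (position R v) < 0.
  rewrite nmulr_rlt0; first by apply: orient_inside; lia.
  by apply: orient_outside; lia.
have [p [puv pxy]] := segments_meet O1 O2; exists p; split=> //.
apply: (crossing_interior (@polygon_convex R n) _ _ _ _ O1 O2) => //;
  exact: polygon_vertex.
Qed.

Lemma meet_insideC (d e : {set vertex n}) :
  meet_inside R d e -> meet_inside R e d.
Proof.
by move=> [u [v [x [y [-> -> [p [? ? ?]]]]]]]; exists x, y, u, v; split=> //; exists p.
Qed.

(** If the chords do not interleave, [x] and [y] are weakly on one side of the line through [u] and
    [v]. A common point that is not a vertex then forces both onto that line, so that the chords
    coincide; vertices are excluded because they are not interior points. *)
Lemma meet_inside_interleave u v x y :
  (rank u < rank v)%N -> (rank x < rank y)%N -> (u, v) != (x, y) ->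
  meet_inside R [set u; v]%SET [set x; y]%SET <->
  interleave (rank u, rank v) (rank x, rank y).
Proof.
move=> uv xy ne; split; last first.
  rewrite /interleave /= => /orP[]/andP[a b]; first exact: interleave_segments_meet.
  by apply: meet_insideC; apply: interleave_segments_meet.
move=> [u' [v' [x' [y' [euv exy [p [puv pxy pin]]]]]]].
have {u' v' euv}puv : segment (position R u) (position R v) p.
  by have [[-> ->]|[-> ->]] := set2_eq euv; rewrite // segmentC.
have {x' y' exy}pxy : segment (position R x) (position R y) p.
  by have [[-> ->]|[-> ->]] := set2_eq exy; rewrite // segmentC.
have pv w : p <> position R w.
  by move=> e; apply: (vertex_not_interior (R := R) (v := w)); rewrite -e.
have [t t01 pt] := pxy.
have {t01} [t0 t1] : 0 < t /\ 0 < 1 - t.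
  case/andP: t01 => t0 t1; rewrite subr_gt0 !lt_neqAle t0 t1 !andbT.
  split; apply/eqP => e; move: pt.
    by rewrite -e subr0 scale1r scale0r addr0; exact: pv.
  by rewrite e subrr scale1r scale0r add0r; exact: pv.
have h := orient_segment puv pt.
have eqrank w z : rank w = rank z -> w = z by exact: clockwise_rank_inj.
apply: contraT => nx.
have side w : orient (position R u) (position R v) (position R w) =
    0 /\ (rank w = rank u \/ rank w = rank v) \/
  0 < orient (position R u) (position R v) (position R w) /\
    (rank u < rank w < rank v)%N \/
  orient (position R u) (position R v) (position R w) < 0 /\
    ((rank w < rank u)%N || (rank v < rank w)%N).
  have [e1 e2] := orient_endpoint (position R u) (position R v).
  have [/eqrank ->|n1] := eqVneq (rank w) (rank u); first by left; split=> //; left.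
  have [/eqrank ->|n2] := eqVneq (rank w) (rank v); first by left; split=> //; right.
  have [i|o] := boolP ((rank u < rank w < rank v)%N).
    by right; left; split=> //; apply: orient_inside.
  by right; right; split; [apply: orient_outside|]; lia.
have nrank : ~~ ((rank u == rank x) && (rank v == rank y)).
  apply: contra ne => /andP[/eqP/eqrank -> /eqP/eqrank ->]; exact: eqxx.
move: h nx nrank; rewrite /interleave /=.
move: (orient _ _ _) (orient _ _ _) (side x) (side y) => b a sx sy h nx nrank.
exfalso; clear -t0 t1 h nx nrank sx sy uv xy.
case: sx => [[a0 sx]|[[a0 sx]|[a0 sx]]]; case: sy => [[b0 sy]|[[b0 sy]|[b0 sy]]];
  solve [lia | nra].
Qed.
End Crossing.

(** * B-diagonals and arrows *)

Section ArrowChords.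
Variable n : nat.
Implicit Types a b : arrow n.

(** [chord1] and [chord2] invert the arrow representation: [ordS] undoes the shift [j - 1]
    cyclically, and the test singles out the unmixed pairs. Endpoints are listed by increasing rank;
    for a diameter the two chords coincide. *)
Definition chord1 a : vertex n * vertex n :=
  if a.2 < a.1 < n then (lab a.2, lab (ordS a.1)) else (lab a.2, bar (ordS a.1)).

Definition chord2 a : vertex n * vertex n :=
  if a.2 < a.1 < n then (bar a.2, bar (ordS a.1)) else (lab (ordS a.1), bar a.2).

Definition chord_set (c : vertex n * vertex n) : {set vertex n} := [set c.1; c.2]%SET.

Definition chord_ranks (c : vertex n * vertex n) : nat * nat :=
  (clockwise_rank c.1, clockwise_rank c.2).

Definition arrow_diagonal a : {set {set vertex n}} :=
  [set chord_set (chord1 a); chord_set (chord2 a)]%SET.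

Lemma val_ordS (i : 'I_n.+1) : i.+1 %% n.+1 = if i < n then i.+1 else 0.
Proof.
case: ltnP => h; first by rewrite modn_small.
have iN := ltn_ord i; have -> : i = n :> nat by lia.
by rewrite modnn.
Qed.

Lemma chord1_ranks a : chord_ranks (chord1 a) =
  if a.2 < a.1 < n then (val a.2, a.1.+1)
  else (val a.2, (if a.1 < n then a.1.+1 else 0) + n.+1).
Proof.
rewrite /chord_ranks /chord1; case: ifP => h; rewrite /clockwise_rank;
  rewrite /= val_ordS; last by congr pair; lia.
by rewrite (andP h).2; congr pair; lia.
Qed.

Lemma chord2_ranks a : chord_ranks (chord2 a) =
  if a.2 < a.1 < n then (a.2 + n.+1, a.1.+1 + n.+1)
  else (if a.1 < n then a.1.+1 else 0, a.2 + n.+1).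
Proof.
rewrite /chord_ranks /chord2; case: ifP => h; rewrite /clockwise_rank;
  rewrite /= val_ordS; last by congr pair; lia.
by rewrite (andP h).2; congr pair; lia.
Qed.

Lemma mixed_pairii (i : 'I_n.+1) : mixed_pair i i = diameter i.
Proof. by rewrite /mixed_pair /diameter (finset.setUC [set bar i]%SET) finset.setUid. Qed.

Lemma arrow_diagonal_unmixed (i j : 'I_n.+1) : j < i < n ->
  arrow_diagonal (i, j) = unmixed_pair j (ordS i).
Proof. by move=> h; rewrite /arrow_diagonal /chord1 /chord2 /= h. Qed.

Lemma arrow_diagonal_mixed (i j : 'I_n.+1) : ~~ (j < i < n) ->
  arrow_diagonal (i, j) = mixed_pair j (ordS i).
Proof.
move=> /negPf h; rewrite /arrow_diagonal /chord1 /chord2 /= h /mixed_pair.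
by rewrite /chord_set /= [in X in [set _; X]%SET]finset.setUC.
Qed.

Lemma val_ord_pred (i : 'I_n.+1) : 0 < i -> (i + n.+1).-1 %% n.+1 = i.-1.
Proof.
move=> i0; have -> : (i + n.+1).-1 = i.-1 + n.+1 by lia.
by rewrite modnDr modn_small //; have := ltn_ord i; lia.
Qed.

Lemma diameter_arrowE (i : 'I_n.+1) : diameter_arrow i = (ord_pred i, i).
Proof.
rewrite /diameter_arrow; case: eqP => // ->; congr pair; apply: val_inj => /=.
by rewrite modn_small.
Qed.

(** Backward arrows with tail other than the last label come from unmixed pairs; the others come
    from a diameter or a mixed pair, according to whether the head is the cyclic successor of the
    tail. *)
Lemma arrow_repP a D : 0 < n ->
  arrow_rep D a <-> is_arrow a /\ D = arrow_diagonal a.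
Proof.
move=> n0; split=> [[i|i j ij|i j /andP[j0 ij]|i /andP[i0 iN]]|].
- rewrite diameter_arrowE; have [i0|i0] := posnP i.
    split; first by rewrite /is_arrow -val_eqE /= i0 add0n modn_small // -lt0n.
    rewrite arrow_diagonal_mixed ?ord_predK ?mixed_pairii //.
    by rewrite /= i0 add0n modn_small // ltnn andbF.
  have pi := val_ord_pred i0; have iN := ltn_ord i.
  split; first by rewrite /is_arrow -val_eqE /= pi; lia.
  by rewrite arrow_diagonal_mixed ?ord_predK ?mixed_pairii //= pi; lia.
- have pj : (j + n.+1).-1 %% n.+1 = j.-1 by apply: val_ord_pred; lia.
  have jn := ltn_ord j.
  split; first by rewrite /is_arrow /= -val_eqE /= pj; lia.
  by rewrite arrow_diagonal_unmixed ?ord_predK //= pj; lia.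
- have pj : (j + n.+1).-1 %% n.+1 = j.-1 by apply: val_ord_pred.
  split; first by rewrite /is_arrow /= -val_eqE /= pj; lia.
  by rewrite arrow_diagonal_mixed ?ord_predK //= pj; lia.
- split; first by rewrite /is_arrow /= -val_eqE /=; lia.
  rewrite arrow_diagonal_mixed ?ltnn ?andbF //; congr mixed_pair.
  by apply: val_inj; rewrite /= modnn.
case: a => x y [/= xy ->].
have {}xy : x != y :> nat by apply: contra xy => /eqP/val_inj ->; rewrite eqxx.
have xn := ltn_ord x; have yn := ltn_ord y; have Sx := val_ordS x.
have tail E : arrow_rep E (ord_pred (ordS x), y) -> arrow_rep E (x, y) by rewrite ordSK.
have [h|h] := boolP (y < x < n).
  rewrite arrow_diagonal_unmixed //; apply: tail; apply: rep_unmixed.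
  by rewrite /= Sx; case: ifP; lia.
rewrite arrow_diagonal_mixed //.
have [ySx|ySx] := eqVneq y (ordS x).
  have -> : x = ord_pred y by rewrite ySx ordSK.
  by rewrite ord_predK mixed_pairii -diameter_arrowE; apply: rep_diameter.
have {}ySx : y != ordS x :> nat by apply: contra ySx => /eqP/val_inj ->.
move: Sx; case: ifP => xN Sx.
  by apply: tail; apply: rep_mixed; move: ySx; rewrite /= Sx; lia.
have -> : ordS x = ord0 by apply: val_inj.
have -> : x = ord_max by apply: val_inj => /=; lia.
by apply: rep_mixed1; move: ySx; rewrite /= Sx; lia.
Qed.

Lemma BdiagonalP D : 0 < n ->
  Bdiagonal D <-> exists2 a, is_arrow a & D = arrow_diagonal a.
Proof.
move=> n0; split=> [h|[a aa Da]].
  suff [a /(arrow_repP _ _ n0)[]] : exists a, arrow_rep D a by exists a.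
  case: h => [i|i j ij|i j ji ij].
  - by exists (diameter_arrow i); apply: rep_diameter.
  - by exists (ord_pred j, i); apply: rep_unmixed.
  have [j0|j0] := posnP j.
    exists (ord_max, i); have -> : j = ord0 by apply: val_inj.
    apply: rep_mixed1; move: ij; rewrite xpair_eqE -!val_eqE /= j0 eqxx andbT.
    by have := ltn_ord i; lia.
  by exists (ord_pred j, i); apply: rep_mixed; rewrite j0.
have : arrow_rep D a by apply/arrow_repP.
case=> [i|i j ij|i j /andP[j0 ij]|i /andP[i0 iN]]; constructor => //.
- by rewrite xpair_eqE -!val_eqE /= negb_and -lt0n j0 orbT.
- by rewrite xpair_eqE -!val_eqE /=; lia.
Qed.

Lemma chord_ranks_lt a : is_arrow a ->
  (chord_ranks (chord1 a)).1 < (chord_ranks (chord1 a)).2 /\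
  (chord_ranks (chord2 a)).1 < (chord_ranks (chord2 a)).2.
Proof.
case: a => x y; rewrite /is_arrow chord1_ranks chord2_ranks /= -(val_eqE x y) /= => xy.
have := ltn_ord x; have := ltn_ord y.
by do ![case: ifP => ?] => /=; lia.
Qed.

(** Distinct arrows share no chord, so the crossing criterion for distinct chords applies to all
    four pairs. *)
Lemma chord_ranks_neq a b : is_arrow a -> is_arrow b -> a != b ->
  [&& chord_ranks (chord1 a) != chord_ranks (chord1 b),
      chord_ranks (chord1 a) != chord_ranks (chord2 b),
      chord_ranks (chord2 a) != chord_ranks (chord1 b) &
      chord_ranks (chord2 a) != chord_ranks (chord2 b)].
Proof.
case: a b => x y [x' y']; rewrite /is_arrow xpair_eqE !chord1_ranks !chord2_ranks /=.
rewrite -(val_eqE x y) -(val_eqE x' y') -(val_eqE x x') -(val_eqE y y') /= => xy xy' ne.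
have := ltn_ord x; have := ltn_ord y; have := ltn_ord x'; have := ltn_ord y'.
move: ne xy xy'; move: (nat_of_ord x) (nat_of_ord y) (nat_of_ord x') (nat_of_ord y').
move=> {x y x' y'} x y x' y'.
by do ![case: ifP => ?]; rewrite !xpair_eqE; lia.
Qed.

(** Conditions (5), (6), (2) and (4) for the unordered pair: (5) and (2) appear once in each
    direction. *)
Definition compatible a b : bool :=
  [&& a.2 != b.1, b.2 != a.1, ~~ arrow_cross a b,
      ~~ [&& backward a, forward b & nests a b],
      ~~ [&& backward b, forward a & nests b a] &
      forward a && forward b ==> nests a b || nests b a].

Lemma nestsE a b :
  nests a b = (arrow_lo a <= arrow_lo b) && (arrow_hi b <= arrow_hi a).
Proof.
apply/fintype.subsetP/andP => [h|[h1 h2] z]; last first.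
  by rewrite !inE => /andP[? ?]; apply/andP; lia.
have lohi c : arrow_lo c <= arrow_hi c by rewrite /arrow_lo /arrow_hi; lia.
have lo : arrow_lo b < n.+1.
  by have := ltn_ord b.1; have := ltn_ord b.2; rewrite /arrow_lo; lia.
have hi : arrow_hi b < n.+1.
  by have := ltn_ord b.1; have := ltn_ord b.2; rewrite /arrow_hi; lia.
have := h (Ordinal lo); have := h (Ordinal hi); rewrite !inE /= !lohi !leqnn /=.
by move=> /(_ isT) /andP[? ?] /(_ isT) /andP[].
Qed.

(** Both sides only compare the four labels, so a case split on the shapes of the arrows leaves
    linear arithmetic. *)
Lemma compatibleE a b : is_arrow a -> is_arrow b -> a != b ->
  compatible a b =
  ~~ [|| interleave (chord_ranks (chord1 a)) (chord_ranks (chord1 b)),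
         interleave (chord_ranks (chord1 a)) (chord_ranks (chord2 b)),
         interleave (chord_ranks (chord2 a)) (chord_ranks (chord1 b)) |
         interleave (chord_ranks (chord2 a)) (chord_ranks (chord2 b))].
Proof.
case: a b => x y [x' y']; rewrite /compatible !nestsE /arrow_cross.
rewrite /is_arrow /forward /backward /arrow_lo /arrow_hi.
rewrite xpair_eqE !chord1_ranks !chord2_ranks /=.
rewrite -(val_eqE x y) -(val_eqE x' y') -(val_eqE x x') -(val_eqE y y').
rewrite -(val_eqE y x') -(val_eqE y' x) /= => xy xy' ne.
have := ltn_ord x; have := ltn_ord y; have := ltn_ord x'; have := ltn_ord y'.
move: ne xy xy'; move: (nat_of_ord x) (nat_of_ord y) (nat_of_ord x') (nat_of_ord y').
move=> {x y x' y'} x y x' y'.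
(* Forward, backward with tail below [n], backward with tail [n]: the shape fixes which formula
   gives the ranks of the chords. *)
have kind (u v : nat) : u != v -> u < n.+1 -> v < n.+1 ->
    [\/ ((((u < v) = true) * ((v < u) = false)) * ((minn u v = u) * (maxn u v = v)) *
          ((u < n) = true) * (u < v <= n))%type,
        ((((u < v) = false) * ((v < u) = true)) * ((minn u v = v) * (maxn u v = u)) *
          ((u < n) = true) * (v < u < n))%type |
        ((((u < v) = false) * ((v < u) = true)) * ((minn u v = v) * (maxn u v = u)) *
          ((u < n) = false) * ((v < u) && (u == n)))%type].
  by move=> uv un vn; case: (ltngtP u v) uv => // uv _; case: (ltnP u n) => un';
    [apply: Or31|lia|apply: Or32|apply: Or33]; repeat split; lia.
move=> ne xy xy' y'n x'n yn xn.
have := kind _ _ xy xn yn; have := kind _ _ xy' x'n y'n => {kind}.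
case=> h'; case=> h; rewrite !h !h' /= ?andbT ?andbF /interleave /=;
  move: ne; move: h.2 h'.2 => {h'} h' {h} h;
  clear xy xy' y'n x'n yn xn; move=> ne.
all: by apply/idP/idP => H;
  [rewrite !negb_or; repeat (apply/andP; split)|repeat (apply/andP; split)]; lia.
Qed.
End ArrowChords.

(** * Counting noncrossing chords *)

(** Each chord is sent to the apex of a triangle on its inner side; this is injective with values
    from 1 to [N - 2]. The side from 0 to [N - 1] is allowed as a chord, so the bound is one more
    than the usual [N - 3] diagonals. *)
Lemma noncrossing_size (N : nat) (s : seq (nat * nat)) : uniq s ->
  {in s, forall c, c.1.+1 < c.2 < N} ->
  {in s &, forall c d, ~~ interleave c d} -> size s <= N - 2.
Proof.
move=> s_uniq s_lt s_nc.
(* The neighbour of [c.1] in the polygon cut off by the chord [c]. *)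
pose apex (c : nat * nat) := maxn c.1.+1 (\max_(d <- s | (d.1 == c.1) && (d.2 < c.2)) d.2).
have apex_ge (c d : nat * nat) : d \in s -> d.1 = c.1 -> d.2 < c.2 -> d.2 <= apex c.
  move=> ds dc1 dc2; rewrite leq_max; apply/orP; right.
  by apply: bigmaxn_sup_seq ds _ (leqnn _); rewrite dc1 eqxx.
have apexE c : apex c = c.1.+1 \/
    (c.1, apex c) \in s /\ c.1.+1 <= apex c < c.2.
  rewrite /apex; set m := \max_(_ <- s | _) _.
  (* The empty maximum is 0, which is below [c.1.+1]; otherwise the maximum is attained. *)
  have : m = 0 \/ (c.1, m) \in s /\ m < c.2.
    rewrite /m big_seq_cond.
    apply: (big_ind (fun k => k = 0 \/ (c.1, k) \in s /\ k < c.2)).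
    - by left.
    - by move=> x y Px Py; rewrite /maxn; case: (x < y).
    by move=> [d1 d2] /= /and3P[ds /eqP <- dc]; right.
  case: (leqP m c.1.+1) => h; first by left.
  by case=> [m0|[ms mc]]; [left; lia | right; split=> //; lia].
have apex_lt (c : nat * nat) : c \in s -> c.1 < apex c < c.2.
  move=> /s_lt /andP[c12 _]; case: (apexE c) => [->|[_ /andP[? ?]]]; lia.
(* A common apex lies beyond [d.1], so it is not [c.1.+1], and the chord from [c.1] to it belongs to
   [s] and crosses [d]. *)
have apex_inj (c d : nat * nat) : c \in s -> d \in s ->
    apex c = apex d -> c.1 < d.1 -> False.
  move=> cs ds e cd; have := apex_lt _ cs; have := apex_lt _ ds.
  case: (apexE c) => [|[as_ _]]; first lia.
  by have := s_nc _ _ as_ ds; rewrite /interleave /=; lia.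
rewrite -(size_map apex) -[N - 2](size_iota 1); apply: uniq_leq_size.
  rewrite map_inj_in_uniq // => c d cs ds e.
  case: (ltngtP c.1 d.1) => cd; try by case: (apex_inj _ _ _ _ _ cd).
  have := apex_lt _ cs; have := apex_lt _ ds.
  (* With a common first endpoint, the apex of the longer chord is at least the second endpoint of
     the shorter one. *)
  case: (ltngtP c.2 d.2) => cd2.
  - by have := apex_ge _ _ cs cd cd2; lia.
  - by have := apex_ge _ _ ds (esym cd) cd2; lia.
  by move=> _ _; rewrite [c]surjective_pairing [d]surjective_pairing cd cd2.
move=> _ /mapP[c cs ->]; rewrite mem_iota.
by have := s_lt _ cs; have := apex_lt _ cs; lia.
Qed.

Section Faces.
Variable n : nat.
Implicit Types (a b : arrow n) (S T : {set arrow n}).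

Definition is_diameter_arrow a : bool := a == diameter_arrow a.2.

(** The requirements of [noncrossing_size] for a single arrow. [(0, (n + n).+1)] is the one side of
    the polygon that the gap condition does not exclude. *)
Lemma chords_nondegenerate a : is_arrow a ->
  [&& (chord_ranks (chord1 a)).1.+1 < (chord_ranks (chord1 a)).2,
      (chord_ranks (chord2 a)).1.+1 < (chord_ranks (chord2 a)).2,
      (chord_ranks (chord1 a)).2 < n.+1 + n.+1,
      (chord_ranks (chord2 a)).2 < n.+1 + n.+1,
      chord_ranks (chord1 a) != (0, (n + n).+1),
      chord_ranks (chord2 a) != (0, (n + n).+1) &
      ~~ interleave (chord_ranks (chord1 a)) (chord_ranks (chord2 a))].
Proof.
case: a => x y; rewrite /is_arrow chord1_ranks chord2_ranks /= -(val_eqE x y) /= => xy.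
have := ltn_ord x; have := ltn_ord y; rewrite /interleave.
by do ![case: ifP => ?] => /=; rewrite ?xpair_eqE; lia.
Qed.

Lemma is_diameter_arrowE (x y : 'I_n.+1) : is_diameter_arrow (x, y) =
  (if x < n then y == x.+1 :> nat else y == 0 :> nat).
Proof.
rewrite /is_diameter_arrow diameter_arrowE xpair_eqE eqxx andbT /=.
rewrite -(can2_eq (@ordSK _) (@ord_predK _)) -val_eqE /= val_ordS.
by case: ifP; rewrite eq_sym.
Qed.

(** The half turn exchanges [chord1 a] and [chord2 a], and the diagonals that it fixes are the
    diameters. *)
Lemma chord_ranks12 a : is_arrow a ->
  (chord_ranks (chord1 a) == chord_ranks (chord2 a)) = is_diameter_arrow a.
Proof.
case: a => x y; rewrite is_diameter_arrowE /is_arrow chord1_ranks chord2_ranks /=.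
rewrite -(val_eqE x y) /= => xy.
have := ltn_ord x; have := ltn_ord y.
by do ![case: ifP => ?] => /=; rewrite ?xpair_eqE; lia.
Qed.

Lemma compatible_card T : 0 < n ->
  {in T, forall a, is_arrow a} -> {in T &, forall a b, a != b -> compatible a b} ->
  #|T|.*2 <= (n + n).-1 + count is_diameter_arrow (enum T).
Proof.
move=> n_gt0 Ta Tc.
pose c1 a := chord_ranks (chord1 a); pose c2 a := chord_ranks (chord2 a).
have c1_inj : {in T &, injective c1}.
  move=> a b aT bT e; apply/eqP/contraT => ab.
  by have := chord_ranks_neq (Ta _ aT) (Ta _ bT) ab; rewrite -/(c1 a) e eqxx.
have c2_inj : {in T &, injective c2}.
  move=> a b aT bT e; apply/eqP/contraT => ab.
  by have := chord_ranks_neq (Ta _ aT) (Ta _ bT) ab; rewrite -/(c2 a) e eqxx !andbF.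
(* Diameters contribute only [c1], so that no chord is listed twice. *)
pose s := map c1 (enum T) ++ map c2 [seq a <- enum T | ~~ is_diameter_arrow a].
have sP c : c \in s -> exists2 a, a \in T & c = c1 a \/ c = c2 a.
  rewrite mem_cat => /orP[]/mapP[a].
    by rewrite fintype.mem_enum => aT ->; exists a; [|left].
  by rewrite mem_filter fintype.mem_enum => /andP[_ aT] ->; exists a; [|right].
(* Adjoining the side between the first and last vertices, which crosses nothing, sharpens the bound
   on [s] from [2n] to [2n - 1]. *)
have : size ((0, (n + n).+1) :: s) <= n.+1 + n.+1 - 2.
  apply: noncrossing_size.
  - rewrite cons_uniq cat_uniq !map_inj_in_uniq ?enum_uniq //=; last first.
    + by move=> a b; rewrite !fintype.mem_enum; apply: c1_inj.
    + move=> a b; rewrite mem_filter fintype.mem_enum => /andP[_ aT].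
      by rewrite mem_filter fintype.mem_enum => /andP[_ bT]; apply: c2_inj.
    + rewrite filter_uniq ?enum_uniq // andbT; apply/andP; split.
        apply/negP => /sP[a aT].
        by have /and5P[_ _ _ _ /and3P[n1 n2 _]] := chords_nondegenerate (Ta _ aT);
          case=> /esym/eqP; apply/negP.
      apply/hasPn => c /mapP[a]; rewrite mem_filter fintype.mem_enum => /andP[da aT] ->.
      apply/negP => /mapP[b]; rewrite fintype.mem_enum => bT e.
      have [ab|ab] := eqVneq a b.
        move: da; rewrite -chord_ranks12 ?Ta // => /eqP; apply.
        by rewrite -/(c2 a) e ab.
      have := chord_ranks_neq (Ta _ aT) (Ta _ bT) ab.
      by rewrite -/(c2 a) e eqxx !andbF.
  - move=> c; rewrite inE => /orP[/eqP ->|/sP[a aT]] /=; first lia.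
    have := chords_nondegenerate (Ta _ aT).
    by rewrite -/(c1 a) -/(c2 a) => h [] ->; move: (c1 a) (c2 a) h => [? ?] [? ?] /=; lia.
  have nd0 (c : nat * nat) : c.2 < n.+1 + n.+1 -> ~~ interleave (0, (n + n).+1) c /\
      ~~ interleave c (0, (n + n).+1).
    by rewrite /interleave /= => ?; split; lia.
  have s2 (c : nat * nat) : c \in s -> c.2 < n.+1 + n.+1.
    move=> /sP[a aT]; have := chords_nondegenerate (Ta _ aT).
    by rewrite -/(c1 a) -/(c2 a) => h [] ->; move: (c1 a) (c2 a) h => [? ?] [? ?] /=; lia.
  have irr (c : nat * nat) : ~~ interleave c c by rewrite /interleave; lia.
  have sym (c d : nat * nat) : interleave c d = interleave d c.
    by rewrite /interleave orbC.
  move=> c d; rewrite !inE => /orP[/eqP ->|cs] /orP[/eqP ->|ds] //.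
  - by case: (nd0 _ (s2 _ ds)).
  - by case: (nd0 _ (s2 _ cs)).
  case: (sP _ cs) (sP _ ds) => a aT ca [b bT db].
  have [ab|ab] := eqVneq a b.
    rewrite -ab in db; have := chords_nondegenerate (Ta _ aT).
    by case: ca db => -> [] -> /and5P[_ _ _ _ /and3P[_ _ h]]; rewrite ?irr // sym.
  have := Tc _ _ aT bT ab; rewrite compatibleE ?Ta // !negb_or => /and4P[? ? ? ?].
  by case: ca db => -> [] ->.
rewrite /= size_cat !size_map size_filter -cardE.
have <- : count is_diameter_arrow (enum T) +
    count (fun a => ~~ is_diameter_arrow a) (enum T) = #|T|.
  by rewrite cardE -(count_predC is_diameter_arrow).
by move: (count _ _) (count _ _) => p q; lia.
Qed.
End Faces.

(** * Faces as sets of arrows *)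

Section FaceArrows.
Variables (R : realType) (n : nat).
Implicit Types (a b : arrow n) (S T : {set arrow n}).

(** A set forgets the order of its two endpoints; increasing ranks restore it. *)
Lemma chord_set_ranks_inj (c d : vertex n * vertex n) :
  (chord_ranks c).1 < (chord_ranks c).2 -> (chord_ranks d).1 < (chord_ranks d).2 ->
  chord_set c = chord_set d -> chord_ranks c = chord_ranks d.
Proof.
case: c d => u v [x y] /= uv xy e; have [[-> ->]//|[eu ev]] := set2_eq e.
by move: uv xy; rewrite eu ev; lia.
Qed.

Lemma arrow_diagonal_inj a b : is_arrow a -> is_arrow b ->
  arrow_diagonal a = arrow_diagonal b -> a = b.
Proof.
move=> aa ab e; apply/eqP/contraT => ne.
have [a1 a2] := chord_ranks_lt aa; have [b1 b2] := chord_ranks_lt ab.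
have /and4P[n11 n12 _ _] := chord_ranks_neq aa ab ne.
have : chord_set (chord1 a) \in arrow_diagonal b by rewrite -e set21.
by move=> /set2P[] /chord_set_ranks_inj h; [case/eqP: n11|case/eqP: n12]; apply: h.
Qed.

Lemma Bcross_compatible a b : is_arrow a -> is_arrow b -> a != b ->
  Bcross R (arrow_diagonal a) (arrow_diagonal b) <-> ~~ compatible a b.
Proof.
move=> aa ab ne; rewrite compatibleE // negbK.
have [a1 a2] := chord_ranks_lt aa; have [b1 b2] := chord_ranks_lt ab.
have /and4P[n11 n12 n21 n22] := chord_ranks_neq aa ab ne.
have meetE (c d : vertex n * vertex n) : (chord_ranks c).1 < (chord_ranks c).2 ->
    (chord_ranks d).1 < (chord_ranks d).2 -> chord_ranks c != chord_ranks d ->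
    meet_inside R (chord_set c) (chord_set d) <->
    interleave (chord_ranks c) (chord_ranks d).
  case: c d => u v [x y] /= uv xy cd; apply: meet_inside_interleave => //.
  by apply: contra cd => /eqP[-> ->].
split=> [[d [e [/set2P[] -> /set2P[] -> /meetE h]]]|/or4P[] h].
- by rewrite h.
- by rewrite h // orbT.
- by rewrite h // !orbT.
- by rewrite h // !orbT.
- by exists (chord_set (chord1 a)), (chord_set (chord1 b));
  split; rewrite ?set21 ?set22 //; apply/meetE.
- by exists (chord_set (chord1 a)), (chord_set (chord2 b));
  split; rewrite ?set21 ?set22 //; apply/meetE.
- by exists (chord_set (chord2 a)), (chord_set (chord1 b));
  split; rewrite ?set21 ?set22 //; apply/meetE.
- by exists (chord_set (chord2 a)), (chord_set (chord2 b));
  split; rewrite ?set21 ?set22 //; apply/meetE.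
Qed.

Lemma face_compatible T : 0 < n -> {in T, forall a, is_arrow a} ->
  face R [set arrow_diagonal a | a in T]%SET <->
  {in T &, forall a b, a != b -> compatible a b}.
Proof.
move=> n0 Ta; split=> [[_ Tc] a b aT bT ne|Tc].
  apply: contraT => /(Bcross_compatible (Ta _ aT) (Ta _ bT) ne); case/Tc => //.
  - exact: imset_f.
  - exact: imset_f.
  by apply: contra ne => /eqP/(arrow_diagonal_inj (Ta _ aT) (Ta _ bT)) ->.
split=> [_ /imsetP[a aT ->]|_ _ /imsetP[a aT ->] /imsetP[b bT ->] ne].
  by apply/BdiagonalP => //; exists a => //; apply: Ta.
have {}ne : a != b by apply: contra ne => /eqP ->.
by move=> /(Bcross_compatible (Ta _ aT) (Ta _ bT) ne); rewrite Tc.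
Qed.

Lemma face_arrows F : 0 < n -> face R F -> exists2 T : {set arrow n},
  {in T, forall a, is_arrow a} & F = [set arrow_diagonal a | a in T]%SET.
Proof.
move=> n0 [Fd _]; exists [set a | is_arrow a && (arrow_diagonal a \in F)]%SET.
  by move=> a; rewrite inE => /andP[].
apply/setP => D; apply/idP/imsetP => [DF|[a + ->]]; last by rewrite inE => /andP[].
have [a aa e] := (BdiagonalP D n0).1 (Fd _ DF).
by exists a => //; rewrite inE aa -e.
Qed.

(** Two distinct arrows of the form [(k - 1, k)] do not nest, against (4), and the backward arrow
    [(n + 1, 1)] nests each of them, against (2). *)
Lemma diameter_arrows_incompatible a b : is_arrow a -> is_arrow b ->
  is_diameter_arrow a -> is_diameter_arrow b -> a != b -> ~~ compatible a b.
Proof.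
case: a b => x y [x' y']; rewrite !is_diameter_arrowE xpair_eqE.
rewrite /is_arrow -(val_eqE x y) -(val_eqE x' y') -(val_eqE x x') -(val_eqE y y') /=.
have := ltn_ord x; have := ltn_ord y; have := ltn_ord x'; have := ltn_ord y'.
move=> y'n x'n yn xn xy xy' dx dx' ne.
apply/negP => /and5P[_ _ _ + /andP[]].
rewrite !nestsE /forward /backward /arrow_lo /arrow_hi /= => h1 h2 /implyP h3.
by move: dx dx'; do ![case: ifP => ?] => /eqP ? /eqP ?; lia.
Qed.

Lemma count_diameter_arrows T : {in T, forall a, is_arrow a} ->
  {in T &, forall a b, a != b -> compatible a b} ->
  count (@is_diameter_arrow n) (enum T) <= 1.
Proof.
move=> Ta Tc; rewrite -size_filter.
have : uniq [seq a <- enum T | is_diameter_arrow a] by rewrite filter_uniq ?enum_uniq.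
have : {in [seq a <- enum T | is_diameter_arrow a], forall a,
    a \in T /\ is_diameter_arrow a}.
  by move=> a; rewrite mem_filter fintype.mem_enum => /andP[].
case: [seq a <- _ | _] => [|a [|b s]] //= h /andP[+ _].
rewrite inE negb_or => /andP[ne _].
have [aT da] := h a (mem_head _ _).
have [bT db] : b \in T /\ is_diameter_arrow b by apply: h; rewrite !inE eqxx orbT.
by have := diameter_arrows_incompatible (Ta _ aT) (Ta _ bT) da db ne; rewrite Tc.
Qed.

(** Maximality by counting: a larger face comes from a compatible set with at most one diameter,
    hence with at most [n] arrows. *)
Lemma compatible_facet T : 0 < n -> {in T, forall a, is_arrow a} ->
  {in T &, forall a b, a != b -> compatible a b} -> #|T| = n ->
  facet R [set arrow_diagonal a | a in T]%SET.
Proof.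
move=> n0 Ta Tc Tn; split; first exact/face_compatible.
move=> G Gf TG; have [U Ua GU] := face_arrows n0 Gf.
have Uc : {in U &, forall a b, a != b -> compatible a b}.
  by apply/face_compatible => //; rewrite -GU.
apply/esym/eqP; rewrite eqEcard TG GU.
rewrite [X in _ <= X]card_in_imset; last first.
  by move=> a b aT bT; apply: arrow_diagonal_inj; apply: Ta.
apply: leq_trans (leq_imset_card _ _) _; rewrite Tn.
by have := compatible_card n0 Ua Uc; have := count_diameter_arrows Ua Uc; lia.
Qed.

(** Injectivity of [arrow_diagonal] turns the relation [represents] into an equality of sets. *)
Lemma representsE (S : {set arrow n}) T : 0 < n ->
  {in T, forall a, is_arrow a} ->
  represents S [set arrow_diagonal a | a in T]%SET <-> S = T.
Proof.
move=> n0 Ta.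
have repT a : (exists2 D, D \in [set arrow_diagonal a | a in T]%SET & arrow_rep D a)
    <-> a \in T.
  split=> [[_ /imsetP[b bT ->] /(arrow_repP _ _ n0)[aa]]|aT].
    by move=> /(arrow_diagonal_inj (Ta _ bT) aa) <-.
  exists (arrow_diagonal a); first exact: imset_f.
  by apply/arrow_repP => //; split=> //; exact: Ta.
split=> [h|-> a]; last by split=> /repT.
by apply/setP => a; apply/idP/idP => [/h /repT|/repT /h].
Qed.
End FaceArrows.

Theorem theorem6p4 (R : realType) (n : nat) (S : {set arrow n})
    (n_gt0 : (0 < n)%N) (S_arrows : forall a, a \in S -> is_arrow a)
    (S_card : #|S| = n) :
  (exists F : {set {set {set vertex n}}}, facet R F /\ represents S F)
  <->
  (exists k : 'I_n.+1,
     (* (1) *)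
     unique (fun i : 'I_n.+1 => diameter_arrow i \in S) k /\
     (* (2) *)
     (forall a b, a \in S -> b \in S ->
        backward a -> forward b -> ~~ nests a b) /\
     (k != ord0 -> forall a, a \in S -> backward a ->
        ~~ nests a (diameter_arrow k)) /\
     (* (3) *)
     (k = ord0 -> forall a, a \in S -> ~~ forward a) /\
     (* (4) *)
     (forall a b, a \in S -> b \in S -> forward a -> forward b ->
        nests a b || nests b a) /\
     (k != ord0 -> forall a, a \in S -> forward a ->
        (a.1 <= k.-1)%N /\ (k <= a.2)%N) /\
     (* (5) *)
     (forall a b, a \in S -> b \in S -> a != b -> a.2 != b.1) /\
     (* (6) *)
     (forall a b, a \in S -> b \in S -> ~~ arrow_cross a b)).
Proof.
split=> [[F [[Ff _] SF]]|[k [_ [h2 [_ [_ [h4 [_ [h5 h6]]]]]]]]]; last first.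
  exists [set arrow_diagonal a | a in S]%SET; split; last by apply/representsE.
  apply: compatible_facet => // a b aS bS ne.
  rewrite /compatible h5 // h5 // 1?eq_sym // h6 //=; apply/and3P; split.
  - by apply/negP => /and3P[? ? ?]; apply: (negP (h2 a b _ _ _ _)).
  - by apply/negP => /and3P[? ? ?]; apply: (negP (h2 b a _ _ _ _)).
  by apply/implyP => /andP[? ?]; apply: h4.
have [T Ta FT] := face_arrows n_gt0 Ff.
have ST : S = T by apply/(representsE S n_gt0 Ta); rewrite -FT.
have {Ta T FT ST SF Ff F}Sc : {in S &, forall a b, a != b -> compatible a b}.
  by apply/(face_compatible R n_gt0 S_arrows); rewrite ST -FT.
have diamS (i : 'I_n.+1) : is_diameter_arrow (diameter_arrow i).
  by rewrite /is_diameter_arrow diameter_arrowE /= diameter_arrowE.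
have h2 a b : a \in S -> b \in S -> backward a -> forward b -> ~~ nests a b.
  move=> aS bS ba fb; have [ab|ne] := eqVneq a b.
    by move: ba fb; rewrite ab /backward /forward; lia.
  have /and5P[_ _ _ h _] := Sc _ _ aS bS ne.
  by apply: contra h => ->; rewrite ba fb.
have h4 a b : a \in S -> b \in S -> forward a -> forward b -> nests a b || nests b a.
  move=> aS bS fa fb; have [->|ne] := eqVneq a b; first by rewrite nestsE !leqnn.
  have /and5P[_ _ _ _ /andP[_ /implyP]] := Sc _ _ aS bS ne.
  by apply; rewrite fa.
(* For [#|S| = n] the counting bound reads [2n <= 2n - 1 + d] with [d] diameters, so [d] is
   positive. *)
have [k kS] : exists k, diameter_arrow k \in S.
  have : has (@is_diameter_arrow n) (enum S).
    by rewrite has_count; have := compatible_card n_gt0 S_arrows Sc; rewrite S_card; lia.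
  move=> /hasP[a]; rewrite fintype.mem_enum => aS /eqP e.
  by exists a.2; rewrite -e.
exists k; split.
  split=> // i iS; have [e|ne] := eqVneq (diameter_arrow k) (diameter_arrow i).
    by move: e; rewrite !diameter_arrowE => -[].
  by have := diameter_arrows_incompatible (S_arrows _ kS) (S_arrows _ iS)
       (diamS k) (diamS i) ne; rewrite Sc.
have k_gt0 : k != ord0 -> 0 < k by rewrite lt0n -val_eqE.
have kE : k != ord0 -> ((diameter_arrow k).1 = k.-1 :> nat) * ((diameter_arrow k).2 = k).
  by move=> /k_gt0 k0; rewrite diameter_arrowE /= val_ord_pred.
split=> //; split.
  (* For [k != ord0] the diameter arrow is forward, so this is an instance of (2). *)
  move=> k0 a aS ba; apply: h2 => //; rewrite /forward !kE //.
  by have := k_gt0 k0; lia.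
split.
  (* The interval of the backward arrow [(n + 1, 1)] is everything, so a forward arrow would
     contradict (2). *)
  move=> k0 a aS; apply/negP => fa; move: kS; rewrite k0 => kS.
  have := h2 _ _ kS aS _ fa.
  rewrite /backward nestsE /arrow_lo /arrow_hi /diameter_arrow eqxx /=.
  by move=> /(_ n_gt0)/negP[]; rewrite maxn0 geq_max !leq_ord.
split=> //; split.
  (* The interval of [(k - 1, k)] has two elements, so whichever arrow nests the other, that of [a]
     contains it. *)
  move=> k0 a aS fa; have := k_gt0 k0; have := h4 _ _ kS aS.
  rewrite !nestsE /forward /arrow_lo /arrow_hi !kE //.
  by move: fa; rewrite /forward; lia.
split.
  by move=> a b aS bS ne; have /and5P[] := Sc _ _ aS bS ne.
move=> a b aS bS; have [->|ne] := eqVneq a b; first by rewrite /arrow_cross; lia.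
by have /and5P[] := Sc _ _ aS bS ne.
Qed.
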